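(* Let $M$ be a $q$-starshaped subset of a normed space $X$ and let $S,T:M\to M$ with $q\in\mathrm{Fix}(S)$. Let $\phi:[0,\infty)\to[0,\infty)$ be Lebesgue measurable, Lebesgue summable on each compact subset of $[0,\infty)$, with $\int_0^\epsilon\phi(t)\,dt>0$ for all $\epsilon>0$. Let $\gamma:(0,\infty)\to(0,\infty)$ be nondecreasing with $\gamma(t)<t$ for all $t>0$, with the convention $\gamma(0)=0$. Suppose that: (i) the ordered pair $(S,T)$ is a generalized $\mathcal{JH}$-suboperator pair with order $n_0$ for some $n_0\in\mathbb{N}$; (ii) for all $x,y\in M$ and each $k\in(0,1)$, $$\psi\Big(\int_0^{\|Tx-Ty\|}\phi(t)\,dt\Big)\le F\Big(\psi\Big(\int_0^{\frac1k\gamma(m_3(x,y))}\phi(t)\,dt\Big),\ \varphi\Big(\int_0^{\frac1k\gamma(m_3(x,y))}\phi(t)\,dt\Big)\Big),$$ where $$m_3(x,y)=\max\Big\{\|Sx-Sy\|,d(Sx,[q,Tx]),d(Sy,[q,Ty]),\tfrac12\big[d(Sx,[q,Ty])+d(Sy,[q,Tx])\big]\Big\},$$ and $\psi\in\Psi$, $\varphi\in\Phi_u$, $F\in\mathcal{C}$ are such that $(\psi,\varphi,F)$ is monotone. Then $\mathrm{Fix}(S)\cap\mathrm{Fix}(T)\ne\emptyset$ if one of the following conditions holds: (1a) $cl(T(M))$ is compact, and $S$ and $T$ are continuous on $M$; (1b) $wcl(T(M))$ is weakly compact, $T$ is completely continuous and $S$ is continuous; (1c) $wcl(T(M))$ is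 weakly compact, $S$ is weakly continuous and $S-T$ is demiclosed at $0$; (1d) $M$ is bounded and complete, $T$ is hemicompact and $S$ is continuous.
   Context: $\mathrm{Fix}(T)$ is the set of fixed points of $T$; $cl(A)$, $wcl(A)$ are the closure and weak closure of $A$; $\delta(A)$ is the diameter of $A$; $d(z,A)=\inf_{a\in A}\|z-a\|$. $M$ is $q$-starshaped, with $q\in M$, if for all $x\in M$ the segment $[q,x]=\{(1-k)q+kx:0\le k\le1\}$ is contained in $M$. For self-maps $S,R$ of $M$, $PC(S,R)=\{w:\ w=Sx=Rx\text{ for some }x\in M\}$. $(S,R)$ is a generalized $\mathcal{JH}$-operator pair with order $n\in\mathbb{N}$ ($n\ge1$) if there exist $x\in M$ and $w=Sx=Rx\in PC(S,R)$ with $\|w-x\|\le(\delta(PC(S,R)))^n$. For $M$ $q$-starshaped, $(S,T)$ is a generalized $\mathcal{JH}$-suboperator pair with order $n$ if for each $k\in[0,1]$ the pair $(S,T_k)$ is a generalized $\mathcal{JH}$-operator pair with order $n$, where $T_kx=(1-k)q+kTx$ for $x\in M$. A map $T:M\to M$ is hemicompact if any sequence $\{x_n\}$ in $M$ with $\|x_n-Tx_n\|\to0$ has a convergent subsequence; completely continuous if $x_n\to x$ weakly implies $Tx_n\to Tx$ strongly. A map $G$ from $M$ to $X$ is demiclosed at $0$ if whenever $\{x_n\}\subseteq M$ converges weakly to $x$ and $\{Gx_n\}$ converges to $0$, then $Gx=0$. $\Psi$ is the set of altering distance functions: continuous non-decreasing $\psi:[0,\infty)\to[0,\infty)$ with $\psi(t)=0$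 iff $t=0$. $\Phi_u$ is the set of ultra altering distance functions: continuous nondecreasing $\varphi:[0,\infty)\to[0,\infty)$ with $\varphi(t)>0$ for $t>0$ (and $\varphi(0)\ge0$). $\mathcal{C}$ is the set of $C$-class functions: continuous $F:[0,\infty)^2\to\mathbb{R}$ such that for all $s,t\ge0$: $F(s,t)\le s$, and $F(s,t)=s$ implies $s=0$ or $t=0$. The triple $(\psi,\varphi,F)$ is monotone if for all $x,y\in[0,\infty)$, $x\le y$ implies $F(\psi(x),\varphi(x))\le F(\psi(y),\varphi(y))$. *)

(* Defs.v *)
From HB Require Import structures.
From mathcomp Require Import all_boot all_order all_algebra.
From mathcomp Require Import all_classical all_reals all_analysis.

Set Implicit Arguments.
Unset Strict Implicit.
Unset Printing Implicit Defensive.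

Import Order.TTheory GRing.Theory Num.Theory.
Import numFieldNormedType.Exports.

Local Open Scope classical_set_scope.
Local Open Scope ring_scope.

Section weak_topology.
Variables (R : realType) (X : normedModType R).

Definition dual : Type := {f : {linear X -> R^o} | continuous f}.

(* The type [weak] is [X] with the coarsest topology making every continuous
   linear functional continuous; a set, map or sequence in [X] is cast to [weak]
   to be read in this topology. *)
Definition weak : Type := sup_topology
  (fun f : dual => Topological.on (initial_topology (sval f : X -> R^o))).

HB.instance Definition _ := Topological.on weak.

Definition weakly_cvg (u : nat -> X) (x : X) :=
  (u : nat -> weak) @ \oo --> (x : weak).

Definition wcl (A : set X) : set X := @closure weak A.

Definition weakly_compact (A : set X) := @compact weak A.

Definition weakly_continuous_on (M : set X) (f : X -> X) :=
  {within (M : set weak), continuous (f : weak -> weak)}.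

End weak_topology.

(* Self-maps of [M] are total maps of [X] sending [M] to [M]; only their values
   on [M] matter below. *)
Section self_maps.
Variables (R : realType) (X : normedModType R).
Implicit Types (M A : set X) (S T U : X -> X) (q x z w : X).

Definition segment q x : set X :=
  [set (1 - k) *: q + k *: x | k in `[0, 1]%classic].

Definition starshaped M q := M q /\ forall x, M x -> segment q x `<=` M.

Definition dist_set z A : R := inf [set `|z - a| | a in A].

(* Extended-real valued, as the set may be unbounded (the real-valued [sup]
   would then be 0). *)
Definition diam A : \bar R :=
  ereal_sup [set (`|p.1 - p.2|)%:E | p in A `*` A].

Definition Fix M S : set X := [set x | M x /\ S x = x].

Definition PC M S U : set X :=
  [set w | exists2 x, M x & w = S x /\ w = U x].

Definition JH_pair M S U (n : nat) :=
  exists x w, [/\ M x, w = S x, w = U x &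
    ((`|w - x|)%:E <= diam (PC M S U) ^+ n)%E].

Definition JH_suboperator_pair M q S T (n : nat) :=
  forall k : R, 0 <= k <= 1 ->
    JH_pair M S (fun x => (1 - k) *: q + k *: T x) n.

Definition complete_on M := forall u : nat -> X,
  (forall n, M (u n)) -> cauchy (u @ \oo) ->
  exists2 x, M x & u @ \oo --> x.

Definition hemicompact M T := forall u : nat -> X,
  (forall n, M (u n)) -> `|u n - T (u n)| @[n --> \oo] --> (0 : R) ->
  exists2 s : nat -> nat, {homo s : i j / (i < j)%N} & cvgn (u \o s).

Definition completely_continuous M T := forall (u : nat -> X) x,
  (forall n, M (u n)) -> M x -> weakly_cvg u x -> T (u n) @[n --> \oo] --> T x.

Definition demiclosed0 M (G : X -> X) := forall (u : nat -> X) x,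
  (forall n, M (u n)) -> M x -> weakly_cvg u x ->
  G (u n) @[n --> \oo] --> (0 : X) -> G x = 0.

Definition m3 q S T (x y : X) : R :=
  Num.max (Num.max `|S x - S y| (dist_set (S x) (segment q (T x))))
    (Num.max (dist_set (S y) (segment q (T y)))
      (2^-1 * (dist_set (S x) (segment q (T y)) +
               dist_set (S y) (segment q (T x))))).

End self_maps.

(* A function on [0, +oo[ is a total function on [R] whose values on the negative
   reals are irrelevant. *)
Section control_functions.
Variable R : realType.
Implicit Types (psi vphi gamma phi : R -> R) (F : R -> R -> R).

Definition altering psi :=
  [/\ {within `[0, +oo[, continuous psi},
      {in `[0, +oo[ &, {homo psi : s t / s <= t}},
      forall t, 0 <= t -> 0 <= psi t &
      forall t, 0 <= t -> (psi t = 0 <-> t = 0)].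

Definition ultra_altering vphi :=
  [/\ {within `[0, +oo[, continuous vphi},
      {in `[0, +oo[ &, {homo vphi : s t / s <= t}},
      forall t, 0 <= t -> 0 <= vphi t &
      forall t, 0 < t -> 0 < vphi t].

Definition C_class F :=
  [/\ {within `[0, +oo[ `*` `[0, +oo[,
        continuous (fun p : R * R => F p.1 p.2)},
      forall s t, 0 <= s -> 0 <= t -> F s t <= s &
      forall s t, 0 <= s -> 0 <= t -> F s t = s -> s = 0 \/ t = 0].

Definition monotone_triple psi vphi F := forall x y, 0 <= x -> x <= y ->
  F (psi x) (vphi x) <= F (psi y) (vphi y).

Definition comparison gamma :=
  [/\ {in `]0, +oo[ &, {homo gamma : s t / s <= t}},
      forall t, 0 < t -> 0 < gamma t < t &
      gamma 0 = 0].

(* [lebesgue_measure] lives on the Borel sigma-algebra; its completion is the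
   measure on all Lebesgue measurable sets. *)
Local Notation mu := (@completed_lebesgue_measure R).

Definition int0 phi (u : R) : R := \int[mu]_(t in `[0, u]) phi t.

Definition lebesgue_integrand phi :=
  [/\ forall t, 0 <= t -> 0 <= phi t,
      @measurable_fun _ _
        (caratheodory_type ((wlength idfun)^*)%mu) R `[0, +oo[ phi,
      forall K : set R, compact K -> K `<=` `[0, +oo[ ->
        mu.-integrable K (EFin \o phi) &
      forall e, 0 < e -> 0 < int0 phi e].

End control_functions.

(* Main.v *)
Require Import Defs.
From HB Require Import structures.
From mathcomp Require Import all_boot all_order all_algebra.
From mathcomp Require Import all_classical all_reals all_analysis.

Set Implicit Arguments.
Unset Strict Implicit.
Unset Printing Implicit Defensive.

Import Order.TTheory GRing.Theory Num.Theory.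
Import numFieldNormedType.Exports.

Local Open Scope classical_set_scope.
Local Open Scope ring_scope.

(** For [k = 1] the suboperator hypothesis says that [(S, T)] itself is a
    generalized JH-operator pair. The contractive condition forces
    [‖Tx - Ty‖ < m3 x y] whenever [m3 x y > 0], and at two coincidence points
    [m3 x y = ‖Sx - Sy‖ = ‖Tx - Ty‖]. Hence [PC(S, T)] is a singleton, its
    diameter is [0], and the JH inequality makes the coincidence point a common
    fixed point. *)

Lemma int0_le (R : realType) (phi : R -> R) (u v : R) :
  lebesgue_integrand phi -> 0 <= u -> u <= v -> int0 phi u <= int0 phi v.
Proof.
move=> [phi0 _ phii _] u0 uv.
have sub0 w : (`[0, w]%classic : set R) `<=` `[0, +oo[.
  by move=> t; rewrite /= !in_itv /= => /andP[->].
have iw w := phii _ (@segment_compact _ 0 w) (sub0 w).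
(* The interval is Borel, hence Carathéodory measurable, as the completed measure requires. *)
have mw w : measurable (`[0, w]%classic : set
    (caratheodory_type ((wlength (@idfun R))^*)%mu)).
  by apply: sub_caratheodory; exact: measurable_itv.
(* Integrability on compact intervals makes both integrals finite, so they can be compared in the
   extended reals. *)
rewrite /int0 /Rintegral; apply: fine_le.
- exact: integrable_fin_num.
- exact: integrable_fin_num.
apply: ge0_subset_integral => //.
- exact: measurable_int (iw v).
- by move=> t; rewrite /= in_itv /= => /andP[t0 _]; rewrite lee_fin phi0.
- by move=> t; rewrite /= !in_itv /= => /andP[-> /le_trans->].
Qed.

(** Write [I] for [int0 phi b], which is positive. If [b <= a], monotonicity gives [psi I <= psi
    (int0 phi a) <= F (psi I) (vphi I) <= psi I]. Equality in the [C_class] bound then forces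
    [psi I = 0] or [vphi I = 0], both impossible for [I > 0]. *)
Lemma contraction_lt (R : realType) (phi psi vphi : R -> R) (F : R -> R -> R)
    (a b : R) :
  lebesgue_integrand phi ->
  altering psi -> ultra_altering vphi -> C_class F -> 0 <= a -> 0 < b ->
  psi (int0 phi a) <= F (psi (int0 phi b)) (vphi (int0 phi b)) -> a < b.
Proof.
move=> phiP [_ psi_le psi_ge0 psi0] [_ _ vphi_ge0 vphi_gt0] [_ F_le F_eq] a0 b0 ab.
have Ib : 0 < int0 phi b by case: phiP => _ _ _; exact.
have Ib0 := ltW Ib.
rewrite ltNge; apply/negP => ba.
have Iab := int0_le phiP (ltW b0) ba.
have pab : psi (int0 phi b) <= psi (int0 phi a).
  by apply: psi_le; rewrite ?in_itv /= ?andbT // (le_trans Ib0).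
have : F (psi (int0 phi b)) (vphi (int0 phi b)) = psi (int0 phi b).
  by apply/le_anti; rewrite F_le ?psi_ge0 ?vphi_ge0 //= (le_trans pab).
move/F_eq => []; [exact: psi_ge0|exact: vphi_ge0| |].
- by move/psi0 => /(_ Ib0) I0; rewrite I0 ltxx in Ib.
- by move=> v0; have := vphi_gt0 _ Ib; rewrite v0 ltxx.
Qed.

Lemma dist_set_le (R : realType) (X : normedModType R) (z a : X) (A : set X) :
  A a -> dist_set z A <= `|z - a|.
Proof.
move=> Aa; apply: ge_inf; last by exists a.
by exists 0 => _ [b _ <-].
Qed.

Lemma segment_right (R : realType) (X : normedModType R) (q x : X) :
  segment q x x.
Proof.
by exists 1; rewrite ?subrr ?scale0r ?add0r ?scale1r //= in_itv /= ler01 lexx.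
Qed.

(** At a coincidence point [z], [S z] is the endpoint [T z] of the segment from [q]. So the
    distances of [S x] and [S y] to their own segments vanish, and each crossed distance is at most
    [|S x - S y|], as is their average. *)
Lemma m3_coincidence (R : realType) (X : normedModType R) (q : X)
    (S T : X -> X) (x y : X) :
  T x = S x -> T y = S y -> m3 q S T x y = `|S x - S y|.
Proof.
move=> Tx Ty; apply/le_anti/andP; split; last by rewrite /m3 !le_max lexx.
have dle z y' : T y' = S y' -> dist_set (S z) (segment q (T y')) <= `|S z - S y'|.
  by move=> <-; exact: dist_set_le (segment_right _ _).
have dself z : T z = S z -> dist_set (S z) (segment q (T z)) <= `|S x - S y|.
  by move=> /dle/le_trans; apply; rewrite subrr normr0.
rewrite /m3 !ge_max lexx !dself //= mulrC ler_pdivrMr // mulr_natr mulr2n.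
by rewrite lerD ?dle // distrC dle.
Qed.

(** The witness [a] matters: the supremum over an empty set would be [-oo]. *)
Lemma diam_subsingleton (R : realType) (X : normedModType R) (A : set X) (a : X) :
  A a -> (forall b, A b -> b = a) -> diam A = 0%E.
Proof.
move=> Aa Aeq; rewrite /diam -[RHS]ereal_sup1; congr ereal_sup.
apply/seteqP; split=> [_ [[b c] [/= /Aeq -> /Aeq ->] <-]|_ ->] /=.
  by rewrite subrr normr0.
by exists (a, a) => //=; rewrite subrr normr0.
Qed.

Theorem theorem3p5 (R : realType) (X : normedModType R)
  (M : set X) (q : X) (S T : X -> X)
  (phi gamma psi vphi : R -> R) (F : R -> R -> R) (n0 : nat)
  (Mq : starshaped M q)
  (SM : forall x, M x -> M (S x))
  (TM : forall x, M x -> M (T x))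
  (qS : Fix M S q)
  (phiP : lebesgue_integrand phi)
  (gammaP : comparison gamma)
  (n0_gt0 : (0 < n0)%N)
  (ST : JH_suboperator_pair M q S T n0)
  (psiP : altering psi)
  (vphiP : ultra_altering vphi)
  (FC : C_class F)
  (mono : monotone_triple psi vphi F)
  (contr : forall (x y : X) (k : R), M x -> M y -> 0 < k < 1 ->
     psi (int0 phi `|T x - T y|) <=
     F (psi (int0 phi (k^-1 * gamma (m3 q S T x y))))
       (vphi (int0 phi (k^-1 * gamma (m3 q S T x y)))))
  (cond :
     [\/ [/\ compact (closure (T @` M)),
             {within M, continuous S} & {within M, continuous T}],
         [/\ weakly_compact (wcl (T @` M)),
             completely_continuous M T & {within M, continuous S}],
         [/\ weakly_compact (wcl (T @` M)),
             weakly_continuous_on M S & demiclosed0 M (S \- T)] |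
         [/\ bounded_set M, complete_on M,
             hemicompact M T & {within M, continuous S}]]) :
  Fix M S `&` Fix M T !=set0.
Proof.
have coin x y : M x -> M y -> T x = S x -> T y = S y -> S x = S y.
  move=> Mx My Tx Ty; apply/eqP; rewrite -subr_eq0 -normr_le0 leNgt.
  apply/negP => d0; have [_ /(_ _ d0)/andP[g0 gd] _] := gammaP.
  set d := `|S x - S y| in d0 g0 gd.
  (* For this [k], the bound [k^-1 * gamma d] is exactly [d]. *)
  have k01 : 0 < gamma d / d < 1 by rewrite divr_gt0 // ltr_pdivrMr // mul1r.
  have := contr _ _ _ Mx My k01.
  rewrite m3_coincidence // Tx Ty -/d invf_div divfK ?gt_eqF //.
  (* Both integrals now have upper limit [d], so the contraction yields [d < d]. *)
  by move/(contraction_lt phiP psiP vphiP FC (ltW d0) d0); rewrite ltxx.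
have := ST 1; rewrite ler01 lexx => /(_ isT).
have -> : (fun x : X => (1 - 1) *: q + (1 : R) *: T x) = T.
  by apply/funext => z; rewrite subrr scale0r add0r scale1r.
move=> [x [w [Mx wS wT]]]; rewrite (diam_subsingleton (a := w)); last 2 first.
- by exists x.
- by move=> _ [y My [-> ST_y]]; rewrite wS; apply: coin; rewrite // -wS.
(* A positive order makes the power of the zero diameter vanish; order [0] would give the bound
   [1]. *)
rewrite -(prednK n0_gt0) expeS mul0e lee_fin normr_le0 subr_eq0 => /eqP wx.
by exists x; split; split; rewrite // -?wS -?wT.
Qed.
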